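(* Let $p$ be a prime and let $\mu_1,\dots,\mu_{2p-1}$ be probability measures on $\mathbb{Z}/p$. Then there exist an injective map $\pi\colon\mathbb{Z}/p\to[2p-1]$ and coefficients $\lambda_i\ge 0$, $i\in\mathbb{Z}/p$, with $\sum_i\lambda_i=1$, such that $\sum_{i\in\mathbb{Z}/p}\lambda_i(\mu_{\pi(i)}+i)$ is the uniform probability measure on $\mathbb{Z}/p$.
   Context: For a probability measure $\mu$ on $\mathbb{Z}/p$ and $j\in\mathbb{Z}/p$, the shifted measure $\mu+j$ is defined by $(\mu+j)(A)=\mu(A-j)$ for $A\subseteq\mathbb{Z}/p$, where $A-j=\{a-j: a\in A\}$. *)

(* Defs.v *)
From HB Require Import structures.
From mathcomp Require Import all_boot all_order all_algebra.
From mathcomp Require Import all_classical all_reals all_analysis.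

Set Implicit Arguments.
Unset Strict Implicit.
Unset Printing Implicit Defensive.

Import Order.TTheory GRing.Theory Num.Theory.

Local Open Scope classical_set_scope.
Local Open Scope ring_scope.

(* 'Z_p unfolds to 'I_(Zp_trunc p).+2, so this equips 'Z_p with the discrete
   sigma-algebra. *)
HB.instance Definition _ (n : nat) := isPointed.Build 'I_n.+1 ord0.
HB.instance Definition _ (n : nat) := @isMeasurable.Build
  default_measure_display 'I_n.+1 discrete_measurable discrete_measurable0
  discrete_measurableC discrete_measurableU.

Section measures_on_Zp.
Context (p : nat) (R : realType).

Lemma measurable_Zp (A : set 'Z_p) : measurable A.
Proof. by []. Qed.

Definition shift_measure (mu : set 'Z_p -> \bar R) (j : 'Z_p) :
    set 'Z_p -> \bar R :=
  fun A => mu [set a - j | a in A].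

Lemma shift_measureE (mu : set 'Z_p -> \bar R) (j : 'Z_p) :
  shift_measure mu j = pushforward mu (fun x : 'Z_p => x + j : 'Z_p).
Proof.
apply/funext => A; rewrite /shift_measure /pushforward; congr mu.
apply/seteqP; split => [_ [a Aa <-]|x Ax] /=; first by rewrite subrK.
by exists (x + j) => //; rewrite addrK.
Qed.

Section shift_measure_probability.
Variables (mu : probability 'Z_p R) (j : 'Z_p).

Let shift0 : shift_measure mu j set0 = 0%E.
Proof. by rewrite /shift_measure image_set0 measure0. Qed.

Let shift_ge0 A : (0 <= shift_measure mu j A)%E.
Proof. exact: measure_ge0. Qed.

Let shift_sigma_additive : semi_sigma_additive (shift_measure mu j).
Proof.
have mf : measurable_fun setT (fun x : 'Z_p => x + j : 'Z_p) by [].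
rewrite shift_measureE.
exact: (@measure_semi_sigma_additive _ _ _
  (measure_function_pushforward__canonical__measure_function_Measure mu mf)).
Qed.

HB.instance Definition _ := isMeasure.Build _ _ _ (shift_measure mu j)
  shift0 shift_ge0 shift_sigma_additive.

Let shift_setT : shift_measure mu j setT = 1%E.
Proof. by rewrite shift_measureE /pushforward preimage_setT probability_setT. Qed.

HB.instance Definition _ :=
  Measure_isProbability.Build _ _ _ (shift_measure mu j) shift_setT.

End shift_measure_probability.

Definition uniform_Zp : set 'Z_p -> \bar R :=
  mscale (#|{: 'Z_p}|%:R^-1)%:nng counting.

HB.instance Definition _ := Measure.on uniform_Zp.

Let uniform_Zp_setT : uniform_Zp setT = 1%E.
Proof.
rewrite /uniform_Zp /mscale/= /counting asboolT; last exact: finite_finset.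
have -> : size (finmap.enum_fset (fset_set [set: 'Z_p])) = #|{: 'Z_p}|.
  rewrite cardE; apply/perm_size/uniq_perm; rewrite ?finmap.fset_uniq ?enum_uniq//.
  by move=> x; rewrite mem_enum in_fset_set ?in_setT//; exact: finite_finset.
by rewrite -EFinM mulVf// pnatr_eq0 card_ord.
Qed.

HB.instance Definition _ :=
  Measure_isProbability.Build _ _ _ uniform_Zp uniform_Zp_setT.

End measures_on_Zp.

Arguments uniform_Zp : clear implicits.

(* Main.v *)
(* Write [n] for the prime. To an injective assignment [f] attach the square
   matrix of the measures [mu (f i) + i], and count it with the sign of its
   determinant if the all-ones vector is a positive combination of its rows
   ([chi]). Let [count] be the sum over all [f]. Replace the measures by Dirac
   masses at [0] one at a time.

   The signs satisfy a cocycle identity over the maximal minors of an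
   [(n + 1) x n] matrix. Applied to the old and the new copy of the modified
   measure (placed in row [0] by cyclic symmetry, which costs a factor [n]), it
   expresses the change of [count] through terms that each ignore one row of
   [f]; that row can be filled in [(2n - 1) - (n - 1) = n] ways. Hence [count] is
   constant modulo [n ^ 2]. When all measures are Dirac masses every [f] counts
   for [1], and [(2n - 1)(2n - 2)...n] is not divisible by [n ^ 2]. So some [f]
   counts for measures in general position, and the general case follows by
   compactness. *)
Require Import Defs.
From mathcomp Require Import all_boot all_order all_fingroup all_algebra.
From mathcomp Require Import all_classical all_reals all_analysis.
From mathcomp Require Import ring zify.

Set Implicit Arguments.
Unset Strict Implicit.
Unset Printing Implicit Defensive.

Import Order.TTheory GRing.Theory Num.Theory numFieldNormedType.Exports.

Local Open Scope ring_scope.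

(** * Signed positive solvability *)

Section Segment.
Variables (R : realFieldType) (I : finType) (a c : I -> R).

(* The point of the line [a - t c] whose [k]-th coordinate vanishes has all its
   other coordinates positive. When the sign of [c k] is given, it is one of
   the two ends of the segment of nonnegative points of that line. *)
Definition feasible (k : I) : bool :=
  [forall l, (l != k) ==> (0 < a l - a k / c k * c l)].

Hypothesis sum_c : \sum_i c i = 0.
Hypothesis generic : forall k l, k != l -> c k != 0 -> c k * a l != c l * a k.

Lemma segment_factor (k l : I) :
  c l != 0 -> a l - a k / c k * c l = (a l / c l - a k / c k) * c l.
Proof. by move=> cl; rewrite mulrBl divfK. Qed.

(** The two positivity conditions multiply to [- (c k * c l)] times a square. *)
Lemma feasible_uniq (k l : I) :
  0 < c k * c l -> feasible k -> feasible l -> k = l.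
Proof.
move=> ckl /forallP/(_ l)/implyP fk /forallP/(_ k)/implyP fl.
apply/eqP/negPn/negP => kl; have := fl kl; rewrite eq_sym in kl; have := fk kl.
have ck0 : c k != 0 by apply: contraTneq ckl => ->; rewrite mul0r ltxx.
have cl0 : c l != 0 by apply: contraTneq ckl => ->; rewrite mulr0 ltxx.
rewrite !segment_factor // => fk' fl'.
have := mulr_gt0 fl' fk'.
have -> : forall t s x y : R, (t - s) * x * ((s - t) * y) = - (x * y * (t - s) ^+ 2).
  by move=> *; ring.
by rewrite oppr_gt0 ltNge mulr_ge0 ?sqr_ge0 // ltW.
Qed.

(** As [0 < c k], the point of [k] is the end of the segment with the largest [t]. Since [c] has sum
    zero, it has negative coordinates, and the other end is at the largest [a l / c l] among
    these. *)
Lemma feasible_opp (k : I) :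
  0 < c k -> feasible k -> exists2 l, c l < 0 & feasible l.
Proof.
move=> ck fk.
have [l0 cl0] : exists l, c l < 0.
  apply/existsP; apply: contraT; rewrite negb_exists => /forallP ge0.
  suff: 0 < \sum_i c i by rewrite sum_c ltxx.
  rewrite (bigD1 k) //= ltr_pwDl // sumr_ge0 // => i _.
  by rewrite leNgt; exact: ge0.
case: (@Order.TotalTheory.arg_maxP _ _ I l0 (fun l => c l < 0)
  (fun l => a l / c l) cl0) => y cy maxy.
have {}maxy l : c l < 0 -> a l / c l <= a y / c y by exact: maxy.
exists y => //; apply/forallP => l; apply/implyP => ly.
have ck0 : c k != 0 by rewrite gt_eqF.
have cy0 : c y != 0 by rewrite lt_eqF.
have yk : a y / c y < a k / c k.
  have yk : y != k by apply: contraTneq cy => ->; rewrite -leNgt ltW.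
  have := implyP (forallP fk y) yk.
  by rewrite segment_factor // nmulr_lgt0 // subr_lt0.
(* Negative: maximality of [y], strict by [generic]. Positive: feasibility of [k] and [yk]. Zero:
   the coordinate is constant along the line. *)
case: (ltgtP (c l) 0) => cl.
- have cl0' : c l != 0 by rewrite lt_eqF.
  rewrite segment_factor // nmulr_lgt0 // subr_lt0 lt_neqAle maxy // andbT.
  apply: contra_neq (generic ly cl0') => e.
  have -> : a y = a y / c y * c y by rewrite divfK.
  by rewrite -e; field.
- have cl0' : c l != 0 by rewrite gt_eqF.
  rewrite segment_factor // pmulr_lgt0 // subr_gt0.
  have [->//|lk] := eqVneq l k.
  apply: lt_trans yk _; have := implyP (forallP fk l) lk.
  by rewrite segment_factor // pmulr_lgt0 // subr_gt0.
- have lk : l != k by apply: contraTneq ck => <-; rewrite cl ltxx.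
  by have := implyP (forallP fk l) lk; rewrite cl !mulr0.
Qed.

End Segment.

Lemma feasibleN (R : realFieldType) (I : finType) (a c : I -> R) :
  feasible a (fun i => - c i) =1 feasible a c.
Proof.
move=> k; rewrite /feasible; apply: eq_forallb => l.
by rewrite invrN !mulrN mulNr opprK.
Qed.

(** Feasible indices with [c i != 0] form a pair of opposite signs or do not occur. If [c i = 0],
    the quotient in [feasible] is by zero, but [sgz] kills the term. *)
Lemma sum_sgz_feasible (R : realFieldType) (I : finType) (a c : I -> R) :
  \sum_i c i = 0 ->
  (forall k l, k != l -> c k != 0 -> c k * a l != c l * a k) ->
  \sum_i sgz (c i) * (feasible a c i)%:R = 0.
Proof.
move=> sum_c generic.
have [/existsP[k /andP[ck fk]]|] := boolP [exists k, (0 < c k) && feasible a c k].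
  have [l cl fl] := feasible_opp sum_c generic ck fk.
  have kl : l != k by apply: contraTneq cl => ->; rewrite -leNgt ltW.
  rewrite (bigD1 k) //= (bigD1 l) //= fk fl gtr0_sgz // ltr0_sgz //.
  rewrite big1 ?addr0 // => i /andP[ik il].
  case: (boolP (feasible a c i)) => fi; last by rewrite mulr0.
  case: (ltgtP (c i) 0) => ci; last by rewrite ci sgz0 mul0r.
    by case/eqP: il; apply: feasible_uniq fi fl; rewrite nmulr_rgt0.
  by case/eqP: ik; apply: feasible_uniq fi fk; rewrite mulr_gt0.
rewrite negb_exists => /forallP none.
apply: big1 => i _; case: (boolP (feasible a c i)) => fi; last by rewrite mulr0.
case: (ltgtP (c i) 0) => ci; last by rewrite ci sgz0 mul0r.
  (* In the reversed direction this yields a feasible index with positive [c], against [none]. *)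
  have [| | | | l cl fl] := @feasible_opp R I a (fun i => - c i) _ _ i.
  - by rewrite sumrN sum_c oppr0.
  - move=> k l kl; rewrite oppr_eq0 => ck; rewrite !mulNr eqr_opp; exact: generic.
  - by rewrite oppr_gt0.
  - by rewrite feasibleN.
  by have := none l; rewrite -oppr_lt0 cl -feasibleN fl.
by have := none i; rewrite ci fi.
Qed.

Definition pos_solvable (R : realFieldType) n (M : 'M[R]_n) : Prop :=
  exists l : 'rV[R]_n, (forall i, 0 < l 0 i) /\ l *m M = const_mx 1.

(* Singular matrices get the value [0] because [sgz 0 = 0]. *)
Definition chi (R : realFieldType) n (M : 'M[R]_n) : int :=
  if `[< pos_solvable M >] then sgz (\det M) else 0.

(** Leaving [s] free avoids a division when this is applied in [sum_chi_row'], with [s = c 0 i]. *)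
Definition generic_mx (R : pzRingType) m n (X : 'M[R]_(m, n)) : Prop :=
  forall (k l : 'I_m) (v : 'rV[R]_m) s,
  k != l -> v 0 k = 0 -> v 0 l = 0 -> v *m X = const_mx s -> s = 0.

Definition maxminors (R : comNzRingType) n (X : 'M[R]_(n.+1, n)) : 'rV[R]_n.+1 :=
  \row_k ((-1) ^+ k * \det (row' k X)).

(** Repeating column [j] in front of [X] gives a zero determinant; its expansion along the first
    column is coordinate [j]. *)
Lemma maxminors_mul (R : comNzRingType) n (X : 'M[R]_(n.+1, n)) :
  maxminors X *m X = 0.
Proof.
apply/rowP => j; rewrite !mxE.
pose A : 'M[R]_(1 + n) := row_mx (col j X) X.
have : \det A = 0.
  rewrite -det_tr; apply: (@determinant_alternate _ _ _ (lshift n 0) (rshift 1 j)).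
    by rewrite eq_lrshift.
  by move=> i; rewrite mxE row_mxEl [RHS]mxE row_mxEr mxE.
rewrite (expand_det_col A (lshift n 0)) => {2}<-.
apply: eq_bigr => i _; rewrite row_mxEl !mxE mulrC /cofactor addn0.
congr (_ * (_ * \det _)); apply/matrixP => r s.
rewrite mxE [RHS]mxE [RHS]mxE -(row_mxEr (col j X)).
by congr (row_mx _ _ _ _); apply: val_inj.
Qed.

Lemma row'_mulmx (R : pzRingType) m n k (X : 'M[R]_(m.+1, n)) (l : 'rV_m.+1) :
  l 0 k = 0 -> col' k l *m row' k X = l *m X.
Proof.
move=> lk; apply/rowP => j; rewrite !mxE.
rewrite [RHS](bigD1_ord k) //= lk mul0r add0r.
by apply: eq_bigr => i _; rewrite !mxE.
Qed.

Section Cocycle.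
Variables (R : realFieldType) (n : nat) (X : 'M[R]_(n.+1, n)).
Hypothesis Xsum : forall i, \sum_j X i j = 1.
Hypothesis Xgeneric : generic_mx X.

(** If minor [k] is nonzero, the line through [a] directed by the minors contains the only solution
    vanishing at [k], and feasibility is the positivity of its other coordinates. Otherwise both
    sides vanish. *)
Lemma chi_feasible (a : 'rV[R]_n.+1) (k : 'I_n.+1) :
  a *m X = const_mx 1 ->
  (-1) ^+ k * chi (row' k X) =
  sgz (maxminors X 0 k) * (feasible (a 0) (maxminors X 0) k)%:R.
Proof.
move=> aX; set c := maxminors X.
have ck : c 0 k = (-1) ^+ k * \det (row' k X) by rewrite mxE.
have sgck : sgz (c 0 k) = (-1) ^+ k * sgz (\det (row' k X)).
  by rewrite ck sgzM sgzX sgzN1.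
have [ck0|ck0] := eqVneq (c 0 k) 0.
  rewrite ck0 sgz0 mul0r /chi; case: ifP => _; last by rewrite mulr0.
  by rewrite -sgck ck0 sgz0.
have detk : \det (row' k X) != 0.
  by apply: contra_neq ck0; rewrite ck => ->; rewrite mulr0.
have unitk : row' k X \in unitmx by rewrite unitmxE unitfE.
pose b := a - (a 0 k / c 0 k) *: c.
have bk : b 0 k = 0 by rewrite !mxE -/c -ck divfK ?subrr.
have bX : b *m X = const_mx 1.
  by rewrite mulmxBl aX -scalemxAl maxminors_mul scaler0 subr0.
rewrite sgck -mulrA; congr (_ * _).
suff -> : feasible (a 0) (c 0) k = `[< pos_solvable (row' k X) >].
  by rewrite /chi; case: ifP => _; rewrite ?mulr1 ?mulr0.
apply/forallP/asboolP => [feas|[l [l0 lX]] i].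
  exists (col' k b); split; last by rewrite row'_mulmx.
  move=> i; have lki : lift k i != k by rewrite eq_sym neq_lift.
  by move: (implyP (feas (lift k i)) lki); rewrite !mxE.
apply/implyP => ik; rewrite eq_sym in ik.
have [j -> _] := unlift_some ik.
have lb : l = col' k b.
  by rewrite -[l](mulmxK unitk) lX -bX -(row'_mulmx _ bk) mulmxK.
by have := l0 j; rewrite lb !mxE.
Qed.

(* A solution [a] of [a X = 1] spans with the maximal minors the line of all
   solutions, so the nonzero terms of the sum are the two ends, with opposite
   signs, of the segment of nonnegative solutions. *)
Lemma sum_chi_row' : \sum_(k < n.+1) (-1) ^+ k * chi (row' k X) = 0.
Proof.
set c := maxminors X.
have [c0|] := eqVneq c 0.
  apply: big1 => k _; have : c 0 k = 0 by rewrite c0 mxE.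
  rewrite mxE => /eqP; rewrite mulf_eq0 signr_eq0 /= => /eqP detk.
  by rewrite /chi detk sgz0 if_same mulr0.
case/rV0Pn => k ck.
have ck' : c 0 k = (-1) ^+ k * \det (row' k X) by rewrite mxE.
have detk : \det (row' k X) != 0.
  by apply: contra_neq ck; rewrite ck' => ->; rewrite mulr0.
have unitk : row' k X \in unitmx by rewrite unitmxE unitfE.
have [a aX] : exists a : 'rV_n.+1, a *m X = const_mx 1.
  pose l : 'rV[R]_n := const_mx 1 *m invmx (row' k X).
  exists (\row_i (if unlift k i is Some j then l 0 j else 0)).
  rewrite -(@row'_mulmx _ _ _ k); last by rewrite mxE unlift_none.
  rewrite -[RHS](mulmxKV unitk) -/l; congr (_ *m _).
  by apply/rowP => j; rewrite mxE mxE liftK.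
rewrite (eq_bigr _ (fun k _ => chi_feasible k aX)).
apply: sum_sgz_feasible => [|i j ij ci].
  (* The rows of [X] have sum 1, so [X] fixes the all-ones column. *)
  transitivity ((c *m X *m const_mx 1 : 'cV[R]_1) 0 0).
    rewrite -mulmxA [RHS]mxE; apply: eq_bigr => i _.
    rewrite [X in _ = _ * X]mxE (eq_bigr (X i)) ?Xsum ?mulr1 // => j _.
    by rewrite mxE mulr1.
  by rewrite maxminors_mul mul0mx mxE.
have scale_subE (u v : 'rV[R]_n.+1) x y r : (x *: u - y *: v) 0 r = x * u 0 r - y * v 0 r.
  by rewrite !mxE.
apply: contra_neq ci => e.
apply: (Xgeneric (v := c 0 i *: a - a 0 i *: c) ij).
- by rewrite scale_subE mulrC subrr.
- by rewrite scale_subE e mulrC subrr.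
- rewrite mulmxBl -!scalemxAl maxminors_mul aX scaler0 subr0.
  by apply/matrixP => ? ?; rewrite !mxE mulr1.
Qed.

End Cocycle.

(** * Counting injective assignments *)

(** The sign of [s] enters the determinant twice, and solutions are merely permuted. *)
Lemma chi_conj (R : realFieldType) n (M : 'M[R]_n) (s : 'S_n) :
  chi (\matrix_(i, j) M (s i) (s j)) = chi M.
Proof.
set N := \matrix_(i, j) _.
have detN : \det N = \det M.
  have -> : N = row_perm s (col_perm s M) by apply/matrixP => i j; rewrite !mxE.
  rewrite row_permE col_permE !det_mulmx !det_perm mulrC -mulrA -signr_addb.
  by rewrite odd_permV addbb mulr1.
rewrite /chi detN; congr (if _ then _ else _); apply: asbool_equiv_eq.
split=> -[l [l0 lE]].
  exists (\row_i l 0 ((s^-1)%g i)); split=> [i|]; first by rewrite mxE.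
  apply/rowP => j; have := congr1 (fun v : 'rV_n => v 0 ((s^-1)%g j)) lE.
  rewrite !mxE => <-; rewrite (reindex_inj (@perm_inj _ s)); apply: eq_bigr => i _.
  by rewrite !mxE permK permKV.
exists (\row_i l 0 (s i)); split=> [i|]; first by rewrite mxE.
apply/rowP => j; have := congr1 (fun v : 'rV_n => v 0 (s j)) lE.
rewrite !mxE => <-; rewrite [RHS](reindex_inj (@perm_inj _ s)); apply: eq_bigr => i _.
by rewrite !mxE.
Qed.

(* A map that is injective off [i] has exactly [n.+1] injective extensions. *)
Lemma dvdz_sum_fibers (n : nat) (J : finType) (j0 : J) (i : 'I_n.+1)
    (G : {ffun 'I_n.+1 -> J} -> int) :
  #|J| = (2 * n.+1).-1 -> i != 0 ->
  (forall f g : {ffun 'I_n.+1 -> J}, (forall r, r != i -> f r = g r) -> G f = G g) ->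
  (n.+1 %| \sum_(f : {ffun 'I_n.+1 -> J} | injectiveb f && (f ord0 == j0)) G f)%Z.
Proof.
move=> cardJ i0 Goff.
pose upd (h : {ffun 'I_n.+1 -> J}) j := [ffun r => if r == i then j else h r].
(* Maps agreeing off [i] are grouped; resetting the value at [i] to [j0] labels the group. *)
rewrite (partition_big (upd^~ j0) predT) //=.
apply: rpred_sum => h _.
rewrite (eq_bigr (fun=> G h)); last first.
  move=> f /andP[_ /eqP <-]; apply: Goff => r ri; by rewrite ffunE (negPf ri).
pose P := [pred f : {ffun 'I_n.+1 -> J} |
  injectiveb f && (f ord0 == j0) && (upd f j0 == h)].
rewrite (sumr_const P) -mulr_natr dvdz_mull //.
have [/existsP[f0]|none] := boolP [exists f, P f]; last first.
  rewrite (_ : #|P| = 0%N) //; apply: eq_card0 => f; apply: negbTE.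
  by apply: contraNN none => Pf; apply/existsP; exists f.
move=> /andP[/andP[/injectiveP injf0 /eqP f00] /eqP f0h].
suff -> : #|P| = n.+1 by rewrite natz.
(* The value at [i] ranges over the complement of [A], of size [2 * n.+1 - 1 - n = n.+1]. *)
pose A := [set f0 r | r in [set~ i]].
have -> : #|P| = #|~: A|.
  rewrite -(card_imset (mem (~: A)) (f := upd h)); last first.
    by move=> j j' /ffunP/(_ i); rewrite !ffunE eqxx.
  apply: eq_card => f; rewrite !inE.
  apply/idP/imsetP.
    move=> /andP[/andP[/injectiveP injf /eqP f0'] /eqP fh].
    exists (f i).
      rewrite inE; apply/negP => /imsetP[r]; rewrite !inE => ri.
      have <- : f r = f0 r.
        by move: fh; rewrite -f0h => /ffunP/(_ r); rewrite !ffunE (negPf ri).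
      by move/injf/esym/eqP; rewrite (negPf ri).
    apply/ffunP => r; rewrite ffunE; case: eqP => [->//|/eqP ri].
    by rewrite -fh ffunE (negPf ri).
  move=> [j]; rewrite inE => jA ->.
  have hr r : r != i -> h r = f0 r by move=> ri; rewrite -f0h ffunE (negPf ri).
  have i0' : ord0 != i by rewrite eq_sym.
  rewrite ffunE (negPf i0') hr // f00 eqxx andbT.
  apply/andP; split.
    apply/injectiveP => r r'; rewrite !ffunE.
    case: eqP => [->|/eqP ri]; case: eqP => [->//|/eqP ri'].
    - rewrite hr // => jr; case/negP: jA; rewrite jr; apply: imset_f.
      by rewrite !inE.
    - rewrite hr // => jr; case/negP: jA; rewrite -jr; apply: imset_f.
      by rewrite !inE.
    - by rewrite !hr // => /injf0.
  apply/eqP/ffunP => r; rewrite !ffunE; case: eqP => // ->.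
  by rewrite -f0h ffunE eqxx.
rewrite cardsCs finset.setCK card_imset // cardsC1 card_ord cardJ.
lia.
Qed.

Lemma sum_delta_row (R : pzRingType) n (i : 'I_n) :
  \sum_k (delta_mx 0 i : 'rV[R]_n) 0 k = 1.
Proof.
rewrite (bigD1 i) //= mxE !eqxx big1 ?addr0 // => k /negPf ki.
by rewrite mxE ki andbF.
Qed.

Section Count.
Variables (R : realFieldType) (q : nat) (J : finType).
Local Notation n := q.+2.
Implicit Types (nu : J -> 'rV[R]_n) (f : {ffun 'I_n -> J}).

(** The difference [k - i] is cyclic, so row [i] is [nu (f i)] shifted by [i]. The form [q.+2] of
    [n] matches ['Z_p]. *)
Definition cfg_mx nu f : 'M[R]_n := \matrix_(i, k) nu (f i) 0 (k - i).

Definition count nu : int :=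
  \sum_(f : {ffun 'I_n -> J} | injectiveb f) chi (cfg_mx nu f).

(* Simultaneous cyclic shift of rows and columns preserves [chi], so the [n]
   possible rows for [j0] contribute equally. *)
Lemma count_column nu j0 :
  count nu =
  \sum_(f : {ffun 'I_n -> J} | injectiveb f && (j0 \notin codom f)) chi (cfg_mx nu f) +
  (\sum_(f : {ffun 'I_n -> J} | injectiveb f && (f 0 == j0)) chi (cfg_mx nu f)) *+ n.
Proof.
rewrite /count (bigID (fun f : {ffun 'I_n -> J} => j0 \notin codom f)) /=.
congr (_ + _); under eq_bigl do rewrite negbK.
transitivity (\sum_(f : {ffun 'I_n -> J} | injectiveb f)
    \sum_(i : 'I_n | f i == j0) chi (cfg_mx nu f)).
  rewrite [RHS](bigID (fun f : {ffun 'I_n -> J} => j0 \in codom f)) /= [X in _ + X]big1.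
    rewrite addr0; apply: eq_bigr => f /andP[/injectiveP injf /codomP[i ->]].
    by rewrite (big_pred1 i) // => j /=; rewrite (inj_eq injf).
  move=> f /andP[_ fj]; rewrite big_pred0 // => i; apply: contraNF fj => /eqP <-.
  exact: codom_f.
rewrite (exchange_big_dep predT) //= -[X in _ *+ X](card_ord n) -sumr_const.
apply: eq_bigr => i _.
(* Rotation by [i]: the value of [h f] at [i] is that of [f] at [0]. *)
pose h (f : {ffun 'I_n -> J}) := [ffun r => f (r - i)].
have hinj : injective h.
  move=> f g /ffunP e; apply/ffunP => r.
  by have := e (r + i); rewrite !ffunE addrK.
rewrite (reindex_inj hinj) /=; apply: eq_big => [f|f _].
  rewrite ffunE subrr; congr (_ && _); apply/injectiveP/injectiveP => injf r r'.
    by move=> e; have := injf (r + i) (r' + i); rewrite !ffunE !addrK => /(_ e) /addIr.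
  by rewrite !ffunE => /injf /addIr.
rewrite -(chi_conj (cfg_mx nu f) (perm (addIr (- i)))); congr chi.
apply/matrixP => r k; rewrite !mxE !permE ffunE; congr (nu _ _ _).
by rewrite opprD opprK addrACA addNr addr0.
Qed.

Definition collapse nu j0 : J -> 'rV[R]_n :=
  fun j => if j == j0 then delta_mx 0 0 else nu j.

(* Deleting row [0] gives the matrix after the collapse of [j0]; if [f 0 = j0],
   deleting row [1] gives the matrix before it. *)
Definition step_mx nu j0 f : 'M[R]_(1 + n, n) :=
  col_mx (nu j0) (cfg_mx (collapse nu j0) f).

Lemma step_mx_lift nu j0 f i :
  step_mx nu j0 f (lift 0 i) = cfg_mx (collapse nu j0) f i.
Proof.
apply/funext => k; rewrite /step_mx (_ : lift 0 i = rshift 1 i) ?col_mxEd //.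
exact: val_inj.
Qed.

Lemma step_mx0 nu j0 f k : step_mx nu j0 f 0 k = nu j0 0 k.
Proof.
transitivity (step_mx nu j0 f (lshift n 0) k); last exact: col_mxEu.
by congr (fun_of_matrix _ _ _); apply: val_inj.
Qed.

(** One factor [n] comes from [count_column], the other from [dvdz_sum_fibers], applied to the
    cocycle terms that delete neither of the first two rows. *)
Lemma dvdz_count_collapse nu j0 :
  #|J| = (2 * n).-1 -> (forall j, \sum_k nu j 0 k = 1) ->
  (forall f, injective f -> f 0 = j0 -> generic_mx (step_mx nu j0 f)) ->
  ((n ^ 2)%N %| count (collapse nu j0) - count nu)%Z.
Proof.
move=> cardJ nu1 gen.
have collapse1 j : \sum_k collapse nu j0 j 0 k = 1.
  by rewrite /collapse; case: ifP => // _; exact: sum_delta_row.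
have cfg1 (mu : J -> 'rV[R]_n) f i :
    (forall j, \sum_k mu j 0 k = 1) -> \sum_k cfg_mx mu f i k = 1.
  move=> mu1; rewrite -(mu1 (f i)) [RHS](reindex_inj (addIr (- i))).
  by apply: eq_bigr => k _; rewrite mxE.
have same : \sum_(f : {ffun 'I_n -> J} | injectiveb f && (j0 \notin codom f))
      chi (cfg_mx (collapse nu j0) f) =
    \sum_(f : {ffun 'I_n -> J} | injectiveb f && (j0 \notin codom f)) chi (cfg_mx nu f).
  apply: eq_bigr => f /andP[_ j0f]; congr chi; apply/matrixP => i k.
  rewrite !mxE /collapse; case: eqP => // fi; case/negP: j0f; rewrite -fi.
  exact: codom_f.
rewrite !(count_column _ j0) same opprD addrACA subrr add0r -mulrnBl -sumrB.
rewrite -mulr_natr natz expnS expn1 PoszM dvdz_mul //.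
pose G i f := chi (row' (lift 0 i) (step_mx nu j0 f)).
rewrite (eq_bigr (fun f => - \sum_(i < q.+1)
    (-1) ^+ (lift 0 (lift 0 i) : 'I_n.+1) * G (lift 0 i) f)); last first.
  move=> f /andP[/injectiveP injf /eqP f0].
  have Xsum (i : 'I_(1 + n)) : \sum_k step_mx nu j0 f i k = 1.
    case: (splitP i) => [i0|i1] ii.
      rewrite (_ : i = 0); last by apply: val_inj; rewrite /= ii [i0]ord1.
      by under eq_bigr do rewrite step_mx0.
    rewrite (_ : i = lift 0 i1); last exact: val_inj.
    by rewrite step_mx_lift cfg1.
  have := sum_chi_row' Xsum (gen f injf f0).
  rewrite big_ord_recl big_ord_recl expr0 mul1r expr1 mulN1r addrA => /eqP.
  rewrite addr_eq0 => /eqP <-.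
  have -> : row' ord0 (step_mx nu j0 f) = cfg_mx (collapse nu j0) f.
    by apply/matrixP => i k; rewrite [LHS]mxE step_mx_lift.
  have -> // : row' (lift ord0 ord0) (step_mx nu j0 f) = cfg_mx nu f.
  apply/matrixP => i k; rewrite [LHS]mxE; have [->|i0] := eqVneq i 0.
    rewrite (_ : lift _ _ = 0); last exact: val_inj.
    by rewrite step_mx0 mxE f0 subr0.
  have -> : lift (lift ord0 ord0) i = lift 0 i.
    by apply: val_inj; rewrite /= /bump; case: (i : nat) (i0 : i != 0 :> nat) => [|[]].
  rewrite step_mx_lift !mxE /collapse; case: eqP => // fi.
  by case/eqP: i0; apply: injf; rewrite fi f0.
rewrite sumrN exchange_big /= rpredN; apply: rpred_sum => i _.
rewrite -mulr_sumr dvdz_mull //; apply: (@dvdz_sum_fibers _ _ _ (lift 0 i)) => //.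
(* The value [f (lift 0 i)] enters only the deleted row; the top row does not depend on [f]. *)
move=> f g fg; congr chi; apply/matrixP => r k; rewrite mxE [RHS]mxE.
have := neq_lift (lift 0 (lift 0 i)) r.
case: (unliftP 0 (lift (lift 0 (lift 0 i)) r)) => [r'|] ->; last first.
  by rewrite !step_mx0.
by rewrite (inj_eq lift_inj) eq_sym !step_mx_lift !mxE => /fg ->.
Qed.

End Count.

(** * General position *)

(** The points [e / 2], [e / 3], ... provide [size P] candidates, more than the degree. *)
Lemma exists_small_nonroot (R : realFieldType) (P : {poly R}) (e : R) :
  P != 0 -> 0 < e -> exists x, [/\ 0 < x, x < e & P.[x] != 0].
Proof.
move=> P0 e0; pose x (i : nat) := e / i.+2%:R.
have xe i : 0 < x i < e.
  by rewrite divr_gt0 //= ltr_pdivrMr // ltr_pMr // ltr1n.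
have [/hasP[y /mapP[i _ ->] Py]|] :=
  boolP (has (fun y => P.[y] != 0) (map x (iota 0 (size P)))).
  by exists (x i); have /andP[] := xe i.
rewrite -all_predC => /allP all_root.
suff : (size (map x (iota 0 (size P))) < size P)%N by rewrite size_map size_iota ltnn.
apply: max_poly_roots => //.
  by apply/allP => y /all_root /=; rewrite negbK.
rewrite map_inj_uniq ?iota_uniq // => i j /(mulfI (lt0r_neq0 e0)) /invr_inj /eqP.
by rewrite eqr_nat eqSS eqSS => /eqP.
Qed.

Section Generic.
Variables (R : realFieldType) (n : nat) (J : finType).
Implicit Types (nu h : J -> 'rV[R]_n).

Definition lerp (x : R) nu h : J -> 'rV[R]_n :=
  fun j => (1 - x) *: nu j + x *: h j.

(** By induction, [nu'] is moved slightly towards the witness [h] of a new condition. Each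
    determinant is a polynomial in the step [x], nonzero at [1] for the new condition and at [0] for
    those already met. Total mass is kept, but weights may become negative. *)
Lemma generic_perturb (T : eqType) (N : nat) (s : seq T)
    (A : T -> (J -> 'rV[R]_n) -> 'M[R]_N) nu (e : R) :
  (forall t x (nu h : J -> 'rV[R]_n),
    A t (lerp x nu h) = (1 - x) *: A t nu + x *: A t h) ->
  (forall t, t \in s ->
    exists2 h : J -> 'rV[R]_n, (forall j, \sum_k h j 0 k = 1) & \det (A t h) != 0) ->
  (forall j, \sum_k nu j 0 k = 1) -> 0 < e ->
  exists nu' : J -> 'rV[R]_n, [/\ forall j, \sum_k nu' j 0 k = 1,
                  forall j k, `|nu' j 0 k - nu j 0 k| < e
                & forall t, t \in s -> \det (A t nu') != 0].
Proof.
move=> Aaff; elim: s e => [|t s IHs] e Aw nu1 e0.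
  by exists nu; split=> // j k; rewrite subrr normr0.
have [|//||nu' [nu'1 nu'e nu's]] := IHs (e / 2).
- by move=> u us; apply: Aw; rewrite inE us orbT.
- by rewrite divr_gt0.
have [h h1 ht] := Aw t (mem_head _ _).
pose P u : {poly R} :=
  \det (map_mx polyC (A u nu') + 'X *: map_mx polyC (A u h - A u nu')).
have PE u x : (P u).[x] = \det (A u (lerp x nu' h)).
  rewrite /P -horner_evalE -det_map_mx; congr (\det _); apply/matrixP => i j.
  by rewrite Aaff !mxE /= horner_evalE !hornerE; ring.
pose Q : {poly R} := \prod_(u <- t :: s) P u.
have Q0 : Q != 0.
  rewrite prodf_seq_neq0; apply/allP => u; rewrite inE => /orP[/eqP->|us] /=.
    apply: contraNneq ht => Pt; have := PE t 1; rewrite Pt horner0 => /esym.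
    by rewrite Aaff subrr scale0r add0r scale1r => ->.
  apply: contraNneq (nu's u us) => Pu; have := PE u 0; rewrite Pu horner0 => /esym.
  by rewrite Aaff subr0 scale0r addr0 scale1r => ->.
(* [B] bounds every coordinate of [h - nu'], so a step below [e / 2 / B] costs at most [e / 2]. *)
pose B := 1 + \sum_j \sum_k `|h j 0 k - nu' j 0 k|.
have B0 : 0 < B by rewrite ltr_wpDr // !sumr_ge0 // => *; rewrite sumr_ge0.
have [|x [x0 xe Qx]] := exists_small_nonroot Q0 (e := e / 2 / B).
  by rewrite !divr_gt0.
exists (lerp x nu' h); split.
- move=> j; rewrite (eq_bigr (fun k => (1 - x) * nu' j 0 k + x * h j 0 k)).
    by rewrite big_split /= -!mulr_sumr nu'1 h1 !mulr1 subrK.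
  by move=> k _; rewrite !mxE.
- move=> j k; rewrite !mxE.
  have -> : (1 - x) * nu' j 0 k + x * h j 0 k - nu j 0 k =
    x * (h j 0 k - nu' j 0 k) + (nu' j 0 k - nu j 0 k) by ring.
  apply: le_lt_trans (ler_normD _ _) _; rewrite [e]splitr ler_ltD ?nu'e //.
  rewrite normrM gtr0_norm //; apply: le_trans (_ : x * B <= _).
    rewrite ler_wpM2l ?(ltW x0) // /B (bigD1 j) //= (bigD1 k) //=.
    rewrite -!addrA [leRHS]addrCA lerDl.
    by rewrite !addr_ge0 // ?sumr_ge0 // => *; rewrite sumr_ge0.
  by rewrite -ler_pdivlMr // ltW.
move=> u us; rewrite -PE; move: Qx; rewrite /Q horner_prod prodf_seq_neq0 => /allP.
exact.
Qed.

End Generic.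

Section Bordered.
Variables (R : realFieldType) (n : nat).

(* Up to sign, the determinant of the bordered matrix is that of [X] with
   row [k] replaced by the all-ones row and row [l] deleted. *)
Definition bordered (k l : 'I_n.+1) (X : 'M[R]_(n.+1, n)) : 'M[R]_n.+1 :=
  \matrix_(r, c) if unlift 0 c is Some j then
                   if r == k then 1 else if r == l then 0 else X r j
                 else (r == l)%:R.

(** Putting [- s] at coordinate [k] of [v] gives a left kernel vector of the bordered matrix. *)
Lemma generic_bordered (X : 'M[R]_(n.+1, n)) :
  (forall k l : 'I_n.+1, k != l -> \det (bordered k l X) != 0) -> generic_mx X.
Proof.
move=> det0 k l v s kl vk vl vX.
pose w := \row_r (if r == k then - s else v 0 r).
have wY : w *m bordered k l X = 0.
  apply/rowP => c; rewrite !mxE; case: (unliftP 0 c) => [j ->|->].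
    rewrite (bigD1 k) //= !mxE liftK eqxx mulr1.
    have := congr1 (fun u : 'rV_n => u 0 j) vX.
    rewrite !mxE => <-; rewrite [X in - X + _](bigD1 k) //= vk mul0r add0r.
    rewrite -sumrN -big_split big1 //= => r rk; rewrite !mxE liftK (negPf rk).
    by case: eqP => [->|_]; rewrite ?vl ?mulr0 ?mul0r ?oppr0 ?addr0 // addNr.
  apply: big1 => r _; rewrite !mxE unlift_none.
  case: (eqVneq r l) => [->|]; last by rewrite mulr0.
  by rewrite eq_sym (negPf kl) vl mul0r.
have w0 : w = 0.
  apply/eqP; apply: contraNT (det0 _ _ kl) => w0.
  by apply/det0P; exists w.
by have /rowP/(_ k) := w0; rewrite !mxE eqxx => /eqP; rewrite oppr_eq0 => /eqP.
Qed.

(** In a left kernel vector, the border column kills coordinate [l], column [z] kills [k] since no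
    unit row meets it, and column [th r] then kills [r]. *)
Lemma det_bordered_delta (k l : 'I_n.+1) (X : 'M[R]_(n.+1, n)) (th : 'I_n.+1 -> 'I_n) z :
  k != l ->
  (forall r c, r != k -> r != l -> X r c = (c == th r)%:R) ->
  (forall r r', r != k -> r != l -> r' != k -> r' != l -> th r = th r' -> r = r') ->
  (forall r, r != k -> r != l -> th r != z) ->
  \det (bordered k l X) != 0.
Proof.
move=> kl Xth th_inj thz; apply/negP => /det0P[v v0 vY].
have vl : v 0 l = 0.
  have /rowP/(_ 0) := vY; rewrite !mxE (bigD1 l) //= mxE unlift_none eqxx mulr1.
  rewrite big1 ?addr0 // => r rl; by rewrite mxE unlift_none (negPf rl) mulr0.
have vY' c : v 0 k + \sum_(r | (r != k) && (r != l)) v 0 r * (c == th r)%:R = 0.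
  have /rowP/(_ (lift 0 c)) := vY; rewrite !mxE (bigD1 k) //= mxE liftK eqxx mulr1.
  move=> e; apply: etrans e; congr (_ + _).
  rewrite [RHS](bigD1 l) /=; last by rewrite eq_sym.
  rewrite vl mul0r add0r.
  apply: eq_bigr => r /andP[rk rl]; by rewrite mxE liftK (negPf rk) (negPf rl) Xth.
have vk : v 0 k = 0.
  have := vY' z; rewrite big1 ?addr0 // => r /andP[rk rl].
  by rewrite eq_sym (negPf (thz r rk rl)) mulr0.
case/negP: v0; apply/eqP/rowP => r; rewrite [RHS]mxE.
have [->//|rk] := eqVneq r k; have [->//|rl] := eqVneq r l.
have := vY' (th r); rewrite vk add0r (bigD1 r) ?rk //= eqxx mulr1 big1 ?addr0 //.
move=> r' /andP[/andP[rk' rl'] rr']; case: eqP => [e|]; last by rewrite mulr0.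
by case/eqP: rr'; apply: th_inj.
Qed.

Lemma bordered_affine k l (X Y : 'M[R]_(n.+1, n)) x :
  bordered k l ((1 - x) *: X + x *: Y) = (1 - x) *: bordered k l X + x *: bordered k l Y.
Proof.
apply/matrixP => r c; rewrite !mxE; case: unlift => [j|]; last by ring.
by case: ifP => _; [ring|case: ifP => _; [ring|rewrite !mxE]].
Qed.

End Bordered.

Section Stage.
Variables (R : realFieldType) (q : nat) (J : finType).
Local Notation n := q.+2.
Implicit Types (nu : J -> 'rV[R]_n) (f : {ffun 'I_n -> J}) (s : {set J}).

Definition stage s nu : J -> 'rV[R]_n :=
  fun j => if j \in s then delta_mx 0 0 else nu j.

Lemma collapse_stage s nu j0 : collapse (stage s nu) j0 = stage (j0 |: s) nu.
Proof. by apply/funext => j; rewrite /collapse /stage !inE; case: eqP. Qed.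

Lemma stage_affine s x nu h : stage s (lerp x nu h) = lerp x (stage s nu) (stage s h).
Proof.
apply/funext => j; rewrite /stage /lerp; case: ifP => // _.
by rewrite -scalerDl subrK scale1r.
Qed.

Lemma step_mx_affine j0 f x nu h :
  step_mx (lerp x nu h) j0 f = (1 - x) *: step_mx nu j0 f + x *: step_mx h j0 f.
Proof.
apply/matrixP => r c; rewrite [RHS]mxE [X in _ = X + _]mxE [X in _ = _ + X]mxE.
case: (unliftP 0 r) => [i ->|->]; last by rewrite !step_mx0 !mxE.
rewrite !step_mx_lift !mxE /collapse /lerp; case: ifP => _; last by rewrite !mxE.
by ring.
Qed.

(** With the Dirac mass at [m] for [f 0] and at [0] elsewhere, the step matrix is the identity below
    a top row equal to unit vector [m]. *)
Lemma step_stage_witness s f (k l : 'I_n.+1) :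
  injective f -> f 0 \notin s -> k != l ->
  exists2 h : J -> 'rV[R]_n, (forall j, \sum_k h j 0 k = 1) &
    \det (bordered k l (step_mx (stage s h) (f 0) f)) != 0.
Proof.
move=> injf f0s kl.
(* The top row replaces the unit vector lost with row [k]; if [k = 0] it is itself lost and [m] is
   arbitrary. The unit vector still missing is [z], which is [m] when [l = 0]. *)
pose m := odflt 0 (unlift 0 k); pose z := odflt m (unlift 0 l).
pose th (r : 'I_n.+1) := odflt m (unlift 0 r).
exists (fun j => if j == f 0 then delta_mx 0 m else delta_mx 0 0).
  by move=> j; case: ifP => _; exact: sum_delta_row.
apply: (@det_bordered_delta _ _ _ _ _ th z) => //.
- move=> r c rk rl; rewrite /th; case: (unliftP 0 r) => [i ->|->] /=.
    rewrite step_mx_lift mxE (_ : collapse _ _ _ = delta_mx 0 0) ?mxE ?subr_eq0 //.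
    rewrite /collapse /stage; case: eqP => // _.
    by case: ifP.
  apply: etrans (step_mx0 _ _ _ _) _.
  by rewrite /stage (negPf f0s) eqxx mxE.
- move=> r r' rk rl rk' rl'; rewrite /th.
  case: (unliftP 0 r) rk rl => [i ->|->] /=;
    case: (unliftP 0 r') rk' rl' => [i' ->|->] //=.
  + by move=> _ _ _ _ ->.
  + rewrite /m; case: (unliftP 0 k) => [j ->|->] //=.
    by move=> _ _ + _ ij; rewrite ij eqxx.
  + rewrite /m; case: (unliftP 0 k) => [j ->|->] //=.
    by move=> + _ _ _ ij; rewrite ij eqxx.
- move=> r rk rl; rewrite /th /z /m; move: kl rk rl.
  case: (unliftP 0 k) => [i ->|->] /=; case: (unliftP 0 l) => [j ->|->] //=;
    case: (unliftP 0 r) => [r' ->|->] //=; rewrite ?(inj_eq lift_inj) ?eqxx //.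
Qed.

End Stage.

(** * Existence of a barycenter *)

(** The distance from [l *m M] to [b] has a positive minimum on the compact box, and a small change
    of [M] cannot cancel it. *)
Lemma unsolvable_open (R : realType) m n (M : 'M[R]_(m.+1, n)) (b : 'rV_n) (B : R) :
  0 <= B ->
  (forall l : 'rV_m.+1, (forall i, 0 <= l 0 i <= B) -> l *m M != b) ->
  exists2 d : R, (0 < d) & forall M' : 'M[R]_(m.+1, n),
    (forall i j, `|M' i j - M i j| < d) ->
    forall l : 'rV_m.+1, (forall i, 0 <= l 0 i <= B) -> l *m M' != b.
Proof.
move=> B0 unsolv.
pose g (l : 'rV[R]_m.+1) : R := \sum_j `|\sum_i l 0 i * M i j - b 0 j|.
have g_cont : continuous g.
  move=> l; apply: (@cvg_big R _ +%R 0 predT (@add_continuous _)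
    _ _ _ _ _ (nbhs_filter l)) => j _.
  apply: cvg_norm; apply: cvgB; last exact: cvg_cst.
  apply: (@cvg_big R _ +%R 0 predT (@add_continuous _)
    _ _ _ _ _ (nbhs_filter l)) => i _.
  apply: cvgM; [exact: coord_continuous|exact: cvg_cst].
pose K := [set l : 'rV[R]_m.+1 | forall i, (`[0, B]%classic : set R) (l ord0 i)]%classic.
have [||| c] := @EVT_min_rV R m.+1 g K.
- by exists 0 => i; rewrite /= in_itv /= mxE lexx.
- by apply: (@rV_compact _ _ (fun=> `[0, B]%classic)) => i; exact: segment_compact.
- exact: continuous_subspaceT.
rewrite inE => cK cmin.
have gc : 0 < g c.
  rewrite lt_def sumr_ge0 // andbT; apply: contraNneq (unsolv c _) => [gc0|i]; last first.
    by have := cK i; rewrite /= in_itv.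
  apply/eqP/rowP => j; apply/eqP; rewrite mxE -subr_eq0 -normr_eq0.
  by move/eqP: gc0; rewrite psumr_eq0 // => /allP/(_ j); apply; rewrite mem_index_enum.
(* Changing the entries of [M] by less than [d] moves [g] by at most [d * S]; dividing by [S + 1]
   keeps this below [g c], even if [S = 0]. *)
pose S : R := \sum_(j < n) \sum_(i < m.+1) B.
have S0 : 0 <= S by rewrite sumr_ge0 // => ? _; rewrite sumr_ge0.
exists (g c / (S + 1)); first by rewrite divr_gt0 // ltr_wpDl.
move=> M' MM' l lB; apply/negP => /eqP lM'.
have /cmin : l \in K by rewrite inE => i /=; rewrite in_itv /=; exact: lB.
apply/negP; rewrite -ltNge; apply: (@le_lt_trans _ _ (g c / (S + 1) * S)); last first.
  rewrite mulrAC -mulrA gtr_pMr // ltr_pdivrMr ?mul1r ?ltrDl //.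
  by rewrite ltr_wpDl.
rewrite mulr_sumr; apply: ler_sum => j _; rewrite -lM' mxE -sumrB mulr_sumr.
apply: le_trans (ler_norm_sum _ _ _) _; apply: ler_sum => i _.
have /andP[l0 lB'] := lB i.
rewrite -mulrBr normrM ger0_norm // mulrC distrC ler_pM //; exact: ltW.
Qed.

(** After cancelling the last factor [n], the others lie strictly between [n] and [2 * n]. *)
Lemma not_dvdn_ffact n : prime n -> ~~ (n ^ 2 %| (2 * n).-1 ^_ n)%N.
Proof.
case: n => // n pn; apply/negP; rewrite ffact_prod big_ord_recr.
rewrite (_ : (2 * n.+1).-1 - _ = n.+1)%N; last by rewrite /=; lia.
rewrite expnS expn1 dvdn_pmul2r // Euclid_dvd_prod // big_orE => /existsP[i].
case/andP=> _ /dvdnP[c]; have := ltn_ord i.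
by case: c => [|[|c]]; rewrite /= ?mul0n ?mul1n ?mulSn; nia.
Qed.

Lemma chi1 (R : realFieldType) n : chi (1%:M : 'M[R]_n) = 1.
Proof.
rewrite /chi asboolT ?det1 ?sgz1 //.
exists (const_mx 1); split=> [i|]; first by rewrite mxE.
exact: mulmx1.
Qed.

Section Main.
Variables (R : realType) (q : nat) (J : finType).
Local Notation n := q.+2.
Implicit Types (nu : J -> 'rV[R]_n) (f : {ffun 'I_n -> J}) (s : {set J}).

Lemma count_stageT nu : count (stage [set: J]%SET nu) = ((#|J| ^_ n)%N : int).
Proof.
rewrite /count (eq_bigr (fun=> 1)); last first.
  move=> f _; rewrite (_ : cfg_mx _ _ = 1%:M) ?chi1 //.
  by apply/matrixP => i k; rewrite !mxE /stage inE mxE /= subr_eq0 eq_sym.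
rewrite sumr_const -natz; congr (_ *+ _).
rewrite -[n in RHS]card_ord -card_inj_ffuns; apply: eq_card => f.
by rewrite !inE.
Qed.

Lemma stage_sum1 s nu :
  (forall j, \sum_k nu j 0 k = 1) -> forall j, \sum_k stage s nu j 0 k = 1.
Proof.
by move=> nu1 j; rewrite /stage; case: ifP => // _; exact: sum_delta_row.
Qed.

Lemma dvdz_count_stage nu (s : seq J) :
  #|J| = (2 * n).-1 -> (forall j, \sum_k nu j 0 k = 1) ->
  (forall s f, injective f -> f 0 \notin s ->
    generic_mx (step_mx (stage s nu) (f 0) f)) ->
  ((n ^ 2)%N %| count (stage [set j in s]%SET nu) - count nu)%Z.
Proof.
move=> cardJ nu1 gen; elim: s => [|j s IHs].
  rewrite (_ : stage _ nu = nu) ?subrr ?dvdz0 //.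
  by apply/funext => j; rewrite /stage inE.
rewrite set_cons; have [js|js] := boolP (j \in [set x in s]%SET).
  rewrite (_ : j |: _ = [set x in s]%SET) //.
  by apply/finset.setUidPr; rewrite finset.sub1set.
rewrite -collapse_stage -(subrK (count (stage [set x in s]%SET nu))
  (count (collapse _ _))) -addrA.
apply: rpredD IHs; apply: dvdz_count_collapse => //; first exact: stage_sum1.
by move=> f injf fj; rewrite -fj; apply: gen => //; rewrite fj.
Qed.

Theorem injective_barycenter nu :
  prime n -> #|J| = (2 * n).-1 -> (forall j, \sum_k nu j 0 k = 1) ->
  exists2 f : {ffun 'I_n -> J}, injective f &
    exists2 l : 'rV[R]_n, (forall i, 0 <= l 0 i) & l *m cfg_mx nu f = const_mx 1.
Proof.
move=> pn cardJ nu1; apply: contrapT => nosol.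
(* The box bound [n%:R] suffices: rows of sum 1 force the coordinates of a solution to sum to [n],
   as in [cfg_sum]. *)
have /choice[d dP] f : exists df : R, (0 < df) /\ (injective f ->
    forall M' : 'M[R]_n, (forall i j, `|M' i j - cfg_mx nu f i j| < df) ->
    forall l : 'rV[R]_n, (forall i, 0 <= l 0 i <= n%:R) -> l *m M' != const_mx 1).
  have [/injectiveP injf|/injectiveP ninjf] := boolP (injectiveb f); last by exists 1.
  have [//||df df0 dfP] := @unsolvable_open R _ _ (cfg_mx nu f) (const_mx 1) n%:R.
    move=> l lP; apply/eqP => lM; apply: nosol; exists f => //; exists l => //.
    by move=> i; have /andP[] := lP i.
  by exists df.
pose e := \big[Num.min/1]_f d f.
have e0 : 0 < e by apply: lt_bigmin => // f _; have [] := dP f.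
(* One perturbation serves all stages, assignments and pairs of rows, which are finitely many. *)
pose T := ({set J} * {ffun 'I_n -> J} * 'I_n.+1 * 'I_n.+1)%type.
pose A (t : T) (mu : J -> 'rV[R]_n) :=
  bordered t.1.2 t.2 (step_mx (stage t.1.1.1 mu) (t.1.1.2 0) t.1.1.2).
pose ts := [seq t : T <- enum {: T} |
  [&& injectiveb t.1.1.2, t.1.1.2 0 \notin t.1.1.1 & t.1.2 != t.2]].
have [| |nu' [nu'1 nu'e nu'gen]] := @generic_perturb R n J T _ ts A nu e _ _ nu1 e0.
- by move=> t x mu h; rewrite /A stage_affine step_mx_affine bordered_affine.
- case=> [[[s f] k] l]; rewrite mem_filter /= => /andP[/and3P[/injectiveP injf f0s kl] _].
  exact: step_stage_witness.
have gen s f : injective f -> f 0 \notin s -> generic_mx (step_mx (stage s nu') (f 0) f).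
  move=> injf f0s; apply: generic_bordered => k l kl.
  apply: (nu'gen (s, f, k, l)); rewrite mem_filter /= mem_enum f0s kl !andbT.
  exact/injectiveP.
have cfg_sum f (l : 'rV_n) : l *m cfg_mx nu' f = const_mx 1 -> \sum_i l 0 i = n%:R.
  move=> lE; transitivity (\sum_i \sum_k l 0 i * cfg_mx nu' f i k).
    apply: eq_bigr => i _; rewrite -mulr_sumr -[LHS]mulr1; congr (_ * _).
    rewrite -(nu'1 (f i)) (reindex_inj (addIr (- i))).
    by apply: eq_bigr => k _; rewrite mxE.
  rewrite exchange_big /= (eq_bigr (fun=> 1)) ?sumr_const ?card_ord // => k _.
  by have := congr1 (fun u : 'rV_n => u 0 k) lE; rewrite !mxE.
have count0 : count nu' = 0.
  apply: big1 => f /injectiveP injf; rewrite /chi; case: ifP => // /asboolP[l [l0 lE]].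
  have [_ /(_ injf (cfg_mx nu' f)) far] := dP f.
  suff : l *m cfg_mx nu' f != const_mx 1 by rewrite lE eqxx.
  apply: far => [i k|i].
    rewrite !mxE; apply: lt_le_trans (nu'e _ _) _; exact: bigmin_le.
  rewrite ltW //= -(cfg_sum _ _ lE) (bigD1 i) //= lerDl.
  by rewrite sumr_ge0 // => *; exact: ltW.
have := dvdz_count_stage (enum J) cardJ nu'1 gen.
rewrite count0 subr0 (_ : [set j in _]%SET = [set: J]%SET); last first.
  by apply/setP => j; rewrite !inE mem_enum.
by rewrite count_stageT cardJ; exact/negP/not_dvdn_ffact.
Qed.

End Main.

(** * Measures on Z/p *)

Local Open Scope classical_set_scope.

Lemma measure_Zp_atoms (R : realType) (p : nat)
    (m : {measure set 'Z_p -> \bar R}) (A : set 'Z_p) :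
  m A = (\sum_(k : 'Z_p | k \in A) m [set k])%E.
Proof.
rewrite -measure_bigsetU_ord_cond //.
  rewrite -bigcup_seq_cond; congr (m _); apply/seteqP; split => [k Ak|k [i /= + ->]].
    by exists k => //=; rewrite mem_index_enum mem_set.
  by rewrite mem_index_enum => /set_mem.
by move=> i j _ _ [k [-> ->]].
Qed.

Lemma shift_measure_atom (R : realType) (p : nat) (m : probability 'Z_p R)
    (i k : 'Z_p) :
  shift_measure m i [set k] = m [set k - i].
Proof. by rewrite /shift_measure image_set1. Qed.

Lemma uniform_Zp_atom (R : realType) (p : nat) (k : 'Z_p) :
  uniform_Zp p R [set k] = (#|{: 'Z_p}|%:R^-1)%:E.
Proof.
by rewrite /uniform_Zp /mscale /= /counting asboolT // fset_set1 finmap.cardfs1 mule1.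
Qed.

Theorem theorem1p5 (R : realType) (p : nat) (p_prime : prime p)
    (mu : 'I_(2 * p - 1) -> probability 'Z_p R) :
  exists (pi : 'Z_p -> 'I_(2 * p - 1)) (lambda : 'Z_p -> R),
    [/\ injective pi,
        forall i : 'Z_p, 0 <= lambda i,
        \sum_(i : 'Z_p) lambda i = 1 &
        forall A : set 'Z_p,
          (\sum_(i : 'Z_p)
             (lambda i)%:E * shift_measure (mu (pi i)) i A)%E
          = uniform_Zp p R A].
Proof.
(* ['Z_p] is ['I_(Zp_trunc p).+2] by definition, of size [p] only for [p > 1]. *)
have pE : (Zp_trunc p).+2 = p by apply/Zp_cast/prime_gt1.
pose w j (k : 'Z_p) := fine (mu j [set k]).
have wE j k : mu j [set k] = (w j k)%:E by rewrite fineK ?fin_num_measure.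
have w1 j : \sum_k w j k = 1.
  apply: EFin_inj; rewrite -sumEFin -(@probability_setT _ _ _ (mu j)) measure_Zp_atoms.
  by apply: eq_big => k; [rewrite in_setT|move=> _; rewrite -wE].
have [| | |f injf [l l0 lE]] :=
  @injective_barycenter R (Zp_trunc p) _ (fun j => \row_k w j k).
- by rewrite pE.
- by rewrite card_ord pE subn1.
- by move=> j; rewrite -(w1 j); apply: eq_bigr => k _; rewrite mxE.
(* The all-ones vector has mass [n], so dividing [l] by [n] normalizes the weights. *)
pose n : R := #|{: 'Z_p}|%:R.
have n0 : n != 0 by rewrite pnatr_eq0 card_ord.
have lw k : \sum_i l ord0 i / n * w (f i) (k - i) = n^-1.
  have /rowP/(_ k) := lE; rewrite !mxE => lEk.
  rewrite -[RHS]mul1r -lEk mulr_suml; apply: eq_bigr => i _.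
  by rewrite !mxE mulrAC.
exists f, (fun i => l ord0 i / n); split => //.
- by move=> i; rewrite divr_ge0 ?ler0n.
(* The sum of the weights is found by adding up [lw] over all atoms. *)
- transitivity (\sum_(k : 'Z_p) \sum_i l ord0 i / n * w (f i) (k - i)).
    rewrite exchange_big; apply: eq_bigr => i _; rewrite -mulr_sumr.
    have := w1 (f i); rewrite (reindex_inj (addIr (- i))) /= => ->.
    by rewrite mulr1.
  by rewrite (eq_bigr _ (fun k _ => lw k)) sumr_const -mulr_natr mulVf.
move=> A; rewrite [RHS]measure_Zp_atoms.
transitivity (\sum_(k : 'Z_p | k \in A)
    (\sum_i l ord0 i / n * w (f i) (k - i))%:E)%E; last first.
  by apply: eq_bigr => k _; rewrite lw; exact/esym/uniform_Zp_atom.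
rewrite sumEFin exchange_big -sumEFin; apply: eq_bigr => i _.
rewrite -mulr_sumr [RHS]EFinM -sumEFin; congr (_ * _)%E.
rewrite [LHS]measure_Zp_atoms; apply: eq_bigr => k _.
by rewrite -wE; apply: shift_measure_atom.
Qed.
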